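(* Suppose the OEM offers the coordinating contract with wholesale price $w^\delta$ and endogenous renewal probability. For fixed $b$, $\lambda$ and $\delta$, when $\frac{r-k}{c}\to\infty$, the fraction of the net present value of the total supply chain profit captured by the OEM satisfies $$\frac{\tilde{\pi}^\delta_m}{\Pi^\delta}\to\frac{\delta b\lambda+\delta}{\delta b\lambda+1}.$$
   Context: Parameters: capacity cost $c>0$ per unit, production cost $k\ge 0$ per unit, retail price $r$ with $r-k-c>c$, base demand $b\ge 0$, rate $\lambda>0$ with $\frac1\lambda\ge b$, discount factor $0<\delta<1$. Demand in each product generation is distributed as $b+A$ with $A\sim\mathrm{Exp}(\lambda)$, i.i.d. over generations. The first best capacity is $x^*=b+\frac1\lambda\ln\left(\frac{r-k}{c}\right)$, and the optimal discounted total profit of the centralized supply chain is $$\Pi^{\delta}=\frac{1}{1-\delta}\left((r-k-c)\left(b+\frac{1}{\lambda}\right)-\frac{c}{\lambda}\ln\left(\frac{r-k}{c}\right)\right).$$ In the contract with endogenous renewal probability, the OEM pays a wholesale price per delivered unit and renews the contract for the next generation only if the supplier's capacity $x$ meets the current demand (renewal probability $R(x)=1-e^{-\lambda(x-b)}$ for $x\ge b$, and $0$ otherwise). The wholesale price $$w^\delta = k+\frac{\delta c \left(1+b\lambda+\ln\left(\frac{r-k}{c}\right)\right)+(1-\delta)(r-k)}{1+\delta b\lambda}$$ coordinates the chain, i.e. induces the supplier to choose capacity $x^*$. The OEM earns $\mathbb{E}[(r-w^\delta)\min\{b+A,x^*\}]$ in each generation (irrespective of which supplier it works with), so the net present value of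 its profit is $$\tilde{\pi}_m^{\delta}=\frac{1}{1-\delta}\,(r-w^\delta)\left(b+\frac{1}{\lambda}\left(1-\frac{c}{r-k}\right)\right).$$ *)

(* Defs.v *)
From HB Require Import structures.
From mathcomp Require Import all_boot all_order all_algebra.
From mathcomp Require Import all_classical all_reals all_analysis.

Set Implicit Arguments.
Unset Strict Implicit.
Unset Printing Implicit Defensive.

Import Order.TTheory GRing.Theory Num.Theory.
Import numFieldNormedType.Exports.

Local Open Scope classical_set_scope.
Local Open Scope ring_scope.

(* Mutual independence of a sequence of real random variables: the product rule
   for every finite subfamily, indexed by a duplicate-free list. *)
Definition mutually_independent d (T : measurableType d) (R : realType)
    (P : probability T R) (A : nat -> {RV P >-> R}) : Prop :=
  forall (s : seq nat) (B : nat -> set R),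
    uniq s -> (forall i, measurable (B i)) ->
    P (\bigcap_(i in [set` s]) (A i @^-1` B i))
    = (\prod_(i <- s) P (A i @^-1` B i))%E.

Definition iid_exponential d (T : measurableType d) (R : realType)
    (P : probability T R) (lambda : R) (A : nat -> {RV P >-> R}) : Prop :=
  (forall n, distribution P (A n) = exponential_prob lambda :> (set R -> \bar R))
  /\ mutually_independent A.

Section supply_chain.
Context d (T : measurableType d) (R : realType) (P : probability T R).
Variables (A : nat -> {RV P >-> R}) (b lambda delta : R).

Definition demand (n : nat) (w : T) : R := b + A n w.

(* min(demand, capacity) has a finite expectation under the exponential law, so
   [fine] loses no information in the next two definitions. *)
Definition chain_profit (c k r : R) (x : R) (n : nat) : R :=
  fine ('E_P[(fun w => (r - k) * Num.min (demand n w) x - c * x)%R])%E.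

Definition oem_profit (r wholesale : R) (x : R) (n : nat) : R :=
  fine ('E_P[(fun w => (r - wholesale) * Num.min (demand n w) x)%R])%E.

(* Generation 0 is undiscounted. *)
Definition npv (profit : nat -> R) : R :=
  limn (series (fun n => delta ^+ n * profit n)).

(* The capacity cost is incurred anew in every generation, and the same capacity
   is installed in all of them. *)
Definition optimal_chain_npv (c k r : R) : R :=
  sup [set npv (chain_profit c k r x) | x in [set x : R | 0 <= x]].

Definition first_best_capacity (c k r : R) : R :=
  b + lambda^-1 * ln ((r - k) / c).

Definition coordinating_wholesale_price (c k r : R) : R :=
  k + (delta * c * (1 + b * lambda + ln ((r - k) / c))
       + (1 - delta) * (r - k)) / (1 + delta * b * lambda).

(* At the coordinating wholesale price the supplier installs the first best
   capacity; the OEM's income does not depend on which supplier it works with,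
   so no renewal probability enters its net present value. *)
Definition oem_npv (c k r : R) : R :=
  npv (oem_profit r (coordinating_wholesale_price c k r)
                  (first_best_capacity c k r)).

End supply_chain.

(* Main.v *)
Require Import Defs.
From HB Require Import structures.
From mathcomp Require Import all_boot all_order all_algebra.
From mathcomp Require Import all_classical all_reals all_analysis.
From mathcomp Require Import measurable_realfun ring lra.

(** Every generation has the same expected profit, so both net present values
are a one-generation expectation divided by [1 - delta], and this factor
cancels in the ratio.

The one-generation expectations reduce to the expected sales
[E (min (b + X) x)] for an exponential [X]. Since [X >= 0] almost surely,
[min (b + X) x = min b x + min X (x - b)^+], and integrating the tail
[expR (- lambda * s)] over [0 <= s < t] gives
[E (min X t) = (1 - expR (- lambda * t)) / lambda]
([expectation_capped], [expectation_affine_sales]).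

With margin [m = r - k], the chain maximises [m * E (min (b + X) x) - c * x].
This is a concave function of [x >= b], and the tangent-line inequality
[1 + u <= expR u] at the first best capacity, where
[expR (- lambda * (x - b)) = c / m], shows that this capacity is optimal
([newsvendor_optimum]).

Write [rho = (r - k) / c]. Dividing the two values by the common factor
[c * rho / (1 - delta)], the ratio depends on the cost parameters only through
[rho^-1] and [ln rho / rho] ([oem_shareE]). Both tend to [0] as [rho] tends to
infinity, so the ratio tends to [1 - (1 - delta) / (1 + delta * b * lambda)],
the factors [b + 1 / lambda] cancelling. *)

Set Implicit Arguments.
Unset Strict Implicit.
Unset Printing Implicit Defensive.

Import Order.TTheory GRing.Theory Num.Theory.
Import numFieldNormedType.Exports.

Local Open Scope classical_set_scope.
Local Open Scope ring_scope.

(** * Expected sales under exponential demand *)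

Lemma exponential_prob_negative (R : realType) (lambda : R) :
  exponential_prob lambda `]-oo, 0[ = 0%E.
Proof.
rewrite /exponential_prob integral0_eq// => x /=; rewrite in_itv/=.
by move=> /lt0_exponential_pdf ->.
Qed.

Section exponential_variable.
Context d (T : measurableType d) (R : realType) (P : probability T R).
Variables (lambda : R) (X : {RV P >-> R}).
Hypothesis lambda_gt0 : 0 < lambda.
Hypothesis X_exp :
  distribution P X = exponential_prob lambda :> (set R -> \bar R).

Lemma exponential_ae_ge0 : {ae P, forall w, 0 <= X w}.
Proof.
exists (X @^-1` `]-oo, 0[); split.
- exact: measurable_funPTI.
- rewrite -[LHS]/(distribution P X `]-oo, 0[) X_exp.
  exact: exponential_prob_negative.
- by move=> w /= /negP; rewrite in_itv/= -ltNge.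
Qed.

(** The mass of the negative half-line vanishes, so the distribution function is
the mass of [0, s]; the case [s = 0] is apart because that interval is then a
null singleton. *)
Lemma exponential_ccdf (s : R) : 0 <= s ->
  ccdf X s = (expR (- lambda * s))%:E.
Proof.
move=> s_ge0; rewrite ccdf_1_cdf /cdf X_exp.
have -> : exponential_prob lambda `]-oo, s] = exponential_prob lambda `[0, s].
  have -> : `]-oo, s]%classic = `]-oo, 0[ `|` `[0, s].
    by rewrite -itv_bndbnd_setU// bnd_simp.
  rewrite -X_exp measureU//; last first.
    by rewrite -subset0 => x /= []; rewrite !in_itv/= => ? /andP[]; lra.
  by rewrite /= X_exp exponential_prob_negative add0e.
have [->|s_neq0] := eqVneq s 0.
  by rewrite set_itv1 /exponential_prob integral_set1 mulr0 expR0 sube0.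
have s_gt0 : 0 < s by rewrite lt_neqAle eq_sym s_neq0.
rewrite exponential_prob_itv0c// -!EFinB; congr (_%:E); ring.
Qed.

(** [min X t], with [X] replaced by its positive part: the two agree almost
surely, and nonnegativity everywhere is what the tail formula for the
expectation asks for. *)
Definition capped (t : R) : {RV P >-> R} :=
  min_mfun (max_mfun X (cst 0)) (cst t).

(** The tail of the capped variable is the exponential tail below [t] and [0]
from [t] on. The exponential tail is [lambda^-1] times the exponential density,
so its integral over [0, t] is [lambda^-1] times the mass of [0, t]. *)
Lemma expectation_capped (t : R) : 0 <= t ->
  'E_P[capped t]%E
  = ((1 - expR (- lambda * t)) / lambda)%:E.
Proof.
move=> t_ge0.
rewrite ge0_expectation_ccdf; last first.
  by move=> w; rewrite /capped/= le_min le_max lexx orbT.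
pose tail u := (lambda^-1 * exponential_pdf lambda u)%:E.
have ccdfE s : s \in `[0%R, +oo[%classic ->
    ccdf (capped t) s = (tail \_ `[0%R, t[) s.
  rewrite inE/= in_itv/= andbT => s_ge0.
  rewrite patchE mem_setE in_itv/= s_ge0/=.
  have [st|ts] := ltP s t.
    rewrite /tail exponential_pdfE// mulKf ?gt_eqF// -exponential_ccdf//.
    congr (P _); apply/seteqP; split=> w /=; rewrite /capped/= !in_itv/= !andbT
      lt_min lt_max st andbT.
      by case/orP => //; lra.
    by move=> ->.
  rewrite -[RHS](measure0 P); congr (P _).
  apply/seteqP; split=> w //=; rewrite /capped/= in_itv/= andbT lt_min.
  by move=> /andP[_]; lra.
transitivity
  (\int[lebesgue_measure]_(s in `[0%R, +oo[) (tail \_ `[0%R, t[) s)%E.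
  by apply: eq_integral => s; exact: ccdfE.
rewrite -integral_mkcondr setIidr; last first.
  by apply: subset_itvl; rewrite bnd_simp.
have mpdf (D : set R) :
    measurable_fun D (fun u => (exponential_pdf lambda u)%:E).
  apply/measurable_EFinP/measurable_funTS; exact: measurable_exponential_pdf.
under eq_integral do rewrite /tail EFinM.
rewrite ge0_integralZl_EFin//=; first last.
- by rewrite invr_ge0 ltW.
- exact: mpdf.
- by move=> u _; rewrite lee_fin exponential_pdf_ge0// ltW.
rewrite integral_itv_bndo_bndc// -/(exponential_prob lambda `[0, t]).
have [->|t_neq0] := eqVneq t 0.
  rewrite set_itv1 /exponential_prob integral_set1.
  by rewrite mulr0 expR0 subrr mul0r mule0.
rewrite exponential_prob_itv0c; last by rewrite lt_neqAle eq_sym t_neq0.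
by rewrite -EFinB -EFinM mulrC.
Qed.

(** The value of [E (min (b + X) x)]; the maximum makes it valid also for
capacities below the base demand, which are then sold out. *)
Definition expected_sales (b x : R) : R :=
  Num.min b x + (1 - expR (- lambda * Num.max (x - b) 0)) / lambda.

(** Almost surely [min (b + X) x = min b x + min X (x - b)^+]. The affine form
covers the chain profit and the income of the OEM at once. *)
Lemma expectation_affine_sales (b x u v : R) :
  'E_P[fun w => (u * Num.min (b + X w) x - v)%R]%E
  = (u * expected_sales b x - v)%:E.
Proof.
pose t := Num.max (x - b) 0.
have t_ge0 : 0 <= t by rewrite le_max lexx orbT.
have mX : measurable_fun setT (X : T -> R) by [].
have capped1 : (capped t : T -> R) \in Lfun P 1.
  apply/Lfun1_integrable/measurable_bounded_integrable => //.
    exact: fin_num_fun_lty.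
  exists t; split; first exact: num_real.
  move=> M tM w _ /=; rewrite ger0_norm /capped/= ?ge_min ?(ltW tM) ?orbT//.
  by rewrite le_min le_max lexx orbT.
transitivity ('E_P[(u \o* capped t) \+ cst (u * Num.min b x - v)%R])%E.
  rewrite unlock; apply: ae_eq_integral => //.
  - apply/measurable_EFinP/measurable_funB => //.
    have mS : measurable_fun setT (fun w => Num.min (b + X w) x).
      by apply: measurable_minr => //; exact: measurable_funD.
    by apply: measurable_funM mS.
  - by apply/measurable_EFinP; exact: measurable_funD.
  apply: filterS exponential_ae_ge0 => w X_ge0 _; congr (_%:E).
  rewrite /capped/= /t (max_l X_ge0).
  have [bx|xb] := leP b x.
    rewrite max_l ?subr_ge0//; have [h|h] := leP (b + X w) x.
      by rewrite min_l; [ring | lra].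
    by rewrite min_r; [ring | lra].
  rewrite max_r ?subr_le0 ?(ltW xb)// (min_r X_ge0) min_r; [ring | lra].
rewrite expectationD ?Lfun_cst ?Lfun_scale//.
rewrite expectationZl// expectation_cst expectation_capped//.
by rewrite -EFinM -EFinD /expected_sales -/t; congr (_%:E); ring.
Qed.

End exponential_variable.

(** * The first best capacity *)

Lemma npv_constant (R : realType) (delta p : R) (profit : nat -> R) :
  `|delta| < 1 -> (forall n, profit n = p) ->
  npv delta profit = p / (1 - delta).
Proof.
move=> delta_lt1 profitE; apply/cvg_lim => //.
rewrite (_ : (fun n => _) = geometric p delta).
  exact: cvg_geometric_series.
by apply/funext => n /=; rewrite profitE mulrC.
Qed.

Section newsvendor.
Variables (R : realType) (lambda b c m : R).
Hypotheses (lambda_gt0 : 0 < lambda) (c_gt0 : 0 < c) (c_lt_m : c < m).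

Let capacity := b + lambda^-1 * ln (m / c).

Let ratio_gt0 : 0 < m / c.
Proof. by rewrite divr_gt0// (lt_trans c_gt0). Qed.

Let ln_ratio_ge0 : 0 <= ln (m / c).
Proof. by rewrite ln_ge0// ler_pdivlMr// mul1r ltW. Qed.

(** The first best capacity is the one that demand exceeds with probability
[c / m]. *)
Lemma expected_sales_first_best :
  expected_sales lambda b capacity = b + (1 - c / m) / lambda.
Proof.
have h : 0 <= lambda^-1 * ln (m / c) by rewrite mulr_ge0// invr_ge0 ltW.
rewrite /expected_sales min_l ?lerDl// /capacity addrAC subrr add0r max_l//.
by rewrite mulNr mulVKf ?gt_eqF// -lnV// lnK ?posrE ?invr_gt0// invf_div.
Qed.

(** Above [b] the profit is concave, and bounded by its tangent at the first
best capacity, which is horizontal there. Below [b] every unit is sold, so the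
profit is at most its value at [b], which the tangent bound covers. *)
Lemma newsvendor_optimum (x : R) :
  m * expected_sales lambda b x - c * x
  <= m * expected_sales lambda b capacity - c * capacity.
Proof.
have m_gt0 : 0 < m := lt_trans c_gt0 c_lt_m.
rewrite expected_sales_first_best /expected_sales.
(* In the variable [u = lambda * (x - b)], optimal at [ln (m / c)]. *)
have tangent u : m * (1 - expR (- u)) - c * u <= m - c - c * ln (m / c).
  have := expR_ge1Dx (ln (m / c) - u).
  rewrite expRD lnK ?posrE// => h.
  have : c * (1 + (ln (m / c) - u)) <= m * expR (- u).
    rewrite -(ler_pM2l c_gt0) in h; apply: le_trans h _.
    by rewrite mulrA mulrCA divff ?gt_eqF// mulr1.
  lra.
have scaled (u : R) :
    m * ((1 - expR (- lambda * u)) / lambda) - c * u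
    <= (m - c - c * ln (m / c)) / lambda.
  rewrite ler_pdivlMr//.
  rewrite [leLHS](_ : _ = m * (1 - expR (- (lambda * u))) - c * (lambda * u)).
    exact: tangent.
  by rewrite mulNr; field; rewrite gt_eqF.
have -> : m * (b + (1 - c / m) / lambda) - c * capacity
  = (m - c) * b + (m - c - c * ln (m / c)) / lambda.
  by rewrite /capacity; field; rewrite !gt_eqF.
rewrite mulrDr.
have [bx|xb] := leP b x.
  rewrite max_l ?subr_ge0//; have := scaled (x - b).
  set p := m * (_ / lambda); set q := _ / lambda; lra.
rewrite max_r ?subr_le0 ?(ltW xb)// mulr0 expR0 subrr mul0r mulr0 addr0.
have : 0 <= (m - c) * (b - x) by rewrite mulr_ge0// subr_ge0 ltW.
have := scaled 0; rewrite mulr0 expR0 subrr mul0r !mulr0 subr0.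
set q := _ / lambda; lra.
Qed.

End newsvendor.

(** * The share of the OEM *)

(** Since [ln s < s], taking [s] the square root of [rho] bounds
[ln rho / rho] by [2 / s]. *)
Lemma ln_divr_cvg0 (R : realType) (I : Type) (F : set_system I) (FF : Filter F)
    (rho : I -> R) :
  (forall i, 0 < rho i) -> rho i @[i --> F] --> +oo ->
  ln (rho i) / rho i @[i --> F] --> 0.
Proof.
move=> rho_gt0 rho_infty.
have rhoV : (rho i)^-1 @[i --> F] --> 0.
  by apply/(gtr0_cvgV0 (f := rho)) => //; exact: nearW.
apply: (@squeeze_cvgr _ F FF R (fun=> 0) (fun i => 2 * Num.sqrt (rho i)^-1)).
- have : \forall i \near F, 1 < rho i by move/cvgryPgt: rho_infty; exact.
  apply: filterS => i rho_gt1; apply/andP; split.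
    by rewrite divr_ge0 ?ln_ge0// ltW.
  rewrite sqrtrV ?(ltW (rho_gt0 i))//; set s := Num.sqrt (rho i).
  have s_gt0 : 0 < s by rewrite sqrtr_gt0.
  have -> : rho i = s ^+ 2 by rewrite sqr_sqrtr// ltW.
  rewrite lnXn// ler_pdivrMr ?exprn_gt0// [leRHS](_ : _ = s *+ 2).
    by rewrite ler_pMn2r//; exact/ltW/ln_sublinear.
  by field; rewrite gt_eqF.
- exact: cvg_cst.
- rewrite -[X in _ --> X](mulr0 2) -[X in 2 * X]sqrtr0.
  apply: cvgM; first exact: cvg_cst.
  by apply: continuous_cvg => //; exact: sqrt_continuous.
Qed.

Section supply_chain_values.
Context d (T : measurableType d) (R : realType) (P : probability T R).
Variables (A : nat -> {RV P >-> R}) (b lambda delta : R).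
Hypotheses (lambda_gt0 : 0 < lambda) (A_iid : iid_exponential lambda A).
Hypotheses (delta_gt0 : 0 < delta) (delta_lt1 : delta < 1).

Let norm_delta_lt1 : `|delta| < 1.
Proof. by rewrite gtr0_norm. Qed.

Let A_exp n :
  distribution P (A n) = exponential_prob lambda :> (set R -> \bar R).
Proof. exact: A_iid.1. Qed.

Lemma npv_chain_profit (c k r x : R) :
  npv delta (chain_profit A b c k r x)
  = ((r - k) * expected_sales lambda b x - c * x) / (1 - delta).
Proof.
apply: npv_constant => // n.
rewrite /chain_profit /demand.
by rewrite (expectation_affine_sales lambda_gt0 (A_exp n)).
Qed.

Lemma npv_oem_profit (w r x : R) :
  npv delta (oem_profit A b r w x)
  = (r - w) * expected_sales lambda b x / (1 - delta).
Proof.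
apply: npv_constant => // n.
rewrite -[RHS]subr0 -[RHS]/(fine (_ - 0)%:E).
rewrite -(expectation_affine_sales lambda_gt0 (A_exp n)) /oem_profit.
by congr (fine (expectation _ _)); apply/funext => t; rewrite subr0.
Qed.

(** The supremum is attained, since the first best capacity is nonnegative and
hence admissible. *)
Lemma optimal_chain_npvE (c k r : R) : 0 <= b -> 0 < c -> c < r - k ->
  let x := first_best_capacity b lambda c k r in
  optimal_chain_npv A b delta c k r
  = ((r - k) * expected_sales lambda b x - c * x) / (1 - delta).
Proof.
move=> b_ge0 c_gt0 c_lt x.
have x_ge0 : 0 <= x.
  rewrite addr_ge0// mulr_ge0 ?invr_ge0 ?(ltW lambda_gt0)//.
  by rewrite ln_ge0// ler_pdivlMr// mul1r ltW.
rewrite /optimal_chain_npv -npv_chain_profit; set S := (X in sup X).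
have S_ub : ubound S (npv delta (chain_profit A b c k r x)).
  move=> _ [y _ <-]; rewrite !npv_chain_profit.
  by rewrite ler_pM2r ?invr_gt0 ?subr_gt0// newsvendor_optimum.
apply/le_anti/andP; split.
  by apply: ge_sup => //; exists (npv delta (chain_profit A b c k r x)), x.
by apply: ub_le_sup; [exists (npv delta (chain_profit A b c k r x)) | exists x].
Qed.

(** Both values carry the factor [c * rho / (1 - delta)] with
[rho = (r - k) / c]; without it, their ratio is a function of [rho^-1] and
[ln rho / rho] alone, continuous at [(0, 0)]. *)
Lemma oem_shareE (c k r : R) : 0 <= b -> 0 < c -> c < r - k ->
  let y := ((r - k) / c)^-1 in
  let l := ln ((r - k) / c) / ((r - k) / c) in
  oem_npv A b lambda delta c k r / optimal_chain_npv A b delta c k r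
  = (1 - (delta * ((1 + b * lambda) * y + l) + (1 - delta))
         / (1 + delta * b * lambda))
    * (b + (1 - y) / lambda) / (b + (1 - y) / lambda - (b * y + l / lambda)).
Proof.
move=> b_ge0 c_gt0 c_lt y l.
rewrite optimal_chain_npvE// /oem_npv npv_oem_profit.
rewrite expected_sales_first_best// /coordinating_wholesale_price.
rewrite /first_best_capacity -[c / (r - k)]invf_div.
rewrite {}/l {}/y.
have rho_gt0 : 0 < (r - k) / c by rewrite divr_gt0// (lt_trans c_gt0).
have m_eq : r - k = (r - k) / c * c by rewrite divfK ?gt_eqF.
move: m_eq rho_gt0; set rho := (r - k) / c; set L := ln rho.
clearbody L rho => m_eq rho_gt0.
have dbl_gt0 : 0 < 1 + delta * b * lambda.
  by rewrite ltr_pwDl// !mulr_ge0 ?(ltW delta_gt0) ?(ltW lambda_gt0).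
have d_gt0 : 0 < 1 - delta by rewrite subr_gt0.
have r_eq : r = k + rho * c by rewrite -m_eq addrC subrK.
pose scale := c * rho / (1 - delta).
have scale_neq0 : scale != 0 by rewrite gt_eqF// divr_gt0// mulr_gt0.
set N' := (X in _ = X / _); set D' := (X in _ = _ / X).
transitivity (scale * N' / (scale * D')); last first.
  by rewrite -mulf_div divff// mul1r.
congr (_ / _).
  by rewrite /N' /scale r_eq; field; rewrite !gt_eqF.
by rewrite /D' /scale m_eq; field; rewrite !gt_eqF.
Qed.

End supply_chain_values.

Theorem proposition10
  (R : realType) (b lambda delta : R)
  (b_ge0 : 0 <= b) (lambda_gt0 : 0 < lambda) (b_le : b <= lambda^-1)
  (delta_gt0 : 0 < delta) (delta_lt1 : delta < 1)
  (d : measure_display) (T : measurableType d) (P : probability T R)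
  (A : nat -> {RV P >-> R}) (A_iid : iid_exponential lambda A)
  (I : Type) (F : set_system I) (FF : Filter F) (c k r : I -> R)
  (c_gt0 : forall i, 0 < c i) (k_ge0 : forall i, 0 <= k i)
  (r_gt : forall i, c i < r i - k i - c i)
  (ratio_infty : (r i - k i) / c i @[i --> F] --> +oo) :
  oem_npv A b lambda delta (c i) (k i) (r i)
    / optimal_chain_npv A b delta (c i) (k i) (r i) @[i --> F]
  --> (delta * b * lambda + delta) / (delta * b * lambda + 1).
Proof.
have c_lt i : c i < r i - k i by have := r_gt i; have := c_gt0 i; lra.
pose rho i := (r i - k i) / c i.
have share i : oem_npv A b lambda delta (c i) (k i) (r i)
    / optimal_chain_npv A b delta (c i) (k i) (r i)
  = (1 - (delta * ((1 + b * lambda) * (rho i)^-1 + ln (rho i) / rho i)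
          + (1 - delta)) / (1 + delta * b * lambda))
    * (b + (1 - (rho i)^-1) / lambda)
    / (b + (1 - (rho i)^-1) / lambda
       - (b * (rho i)^-1 + ln (rho i) / rho i / lambda)).
  exact: oem_shareE.
rewrite (eq_cvg _ _ share).
have rho_gt0 i : 0 < rho i by rewrite divr_gt0// (lt_trans (c_gt0 i)).
have y_cvg : (rho i)^-1 @[i --> F] --> 0.
  by apply/(gtr0_cvgV0 (f := rho)) => //; exact: nearW.
have l_cvg : ln (rho i) / rho i @[i --> F] --> 0.
  exact: ln_divr_cvg0.
have dbl_gt0 : 0 < 1 + delta * b * lambda.
  by rewrite ltr_pwDl// !mulr_ge0 ?(ltW delta_gt0) ?(ltW lambda_gt0).
have S_gt0 : 0 < b + 1 / lambda by rewrite ltr_wpDl// divr_gt0.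
have S_cvg : b + (1 - (rho i)^-1) / lambda @[i --> F] --> b + 1 / lambda.
  apply: cvgD; first exact: cvg_cst.
  apply: cvgMl; rewrite -[X in _ --> X]subr0.
  by apply: cvgB => //; exact: cvg_cst.
(* The limit is the expression of [share] at [rho^-1 = ln rho / rho = 0]. *)
have -> : (delta * b * lambda + delta) / (delta * b * lambda + 1)
  = (1 - (delta * ((1 + b * lambda) * 0 + 0) + (1 - delta))
         / (1 + delta * b * lambda))
    * (b + 1 / lambda) / (b + 1 / lambda - (b * 0 + 0 / lambda)).
  rewrite !mulr0 mul0r !addr0 subr0 mulfK ?gt_eqF//.
  by field; rewrite gt_eqF.
apply: cvgM.
  apply: cvgM => //; apply: cvgB; first exact: cvg_cst.
  apply: cvgMl; apply: cvgD; last exact: cvg_cst.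
  by apply: cvgMr; apply: cvgD => //; exact: cvgMr.
apply: cvgV; first by rewrite mulr0 mul0r addr0 subr0 gt_eqF.
by apply: cvgB => //; apply: cvgD; [exact: cvgMr|exact: cvgMl].
Qed.
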